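(* Let $K=K_1\times\cdots\times K_n$, where each $K_j$ is a non-polar compact subset of $\mathbb C$. Let $$P(z_1,\dots,z_n)=\sum_{k_1=0}^{m_1}\cdots\sum_{k_n=0}^{m_n}a_{k_1\dots k_n}z_1^{k_1}\cdots z_n^{k_n}$$ be a non-zero polynomial with all coefficients $a_{k_1\dots k_n}\in\mathbb Z$, where $m_j\ge0$ is the degree of $P$ in $z_j$. Then $$M(P)\ \ge\ \prod_{N=1}^n\min\big(1,\mathrm{Cap}(K_N)^{m_N}\big).$$ In particular, if $\mathrm{Cap}(K_N)\ge1$ for all $N$, then $M(P)\ge1$.
   Context: $\mu_{K_j}$ is the equilibrium measure of $K_j$ and $\mathrm{Cap}$ is logarithmic capacity. The Mahler measure of $P$ relative to $K$ is $M(P)=\exp[\int\log|P|\,d\nu_K]$, where $\nu_K$ is the normalized Monge–Ampère measure of $K$; for this product set $\nu_K=\mu_{K_1}\otimes\cdots\otimes\mu_{K_n}$. *)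

(* Defs.v *)
From HB Require Import structures.
From mathcomp Require Import all_boot all_order all_algebra.
From mathcomp Require Import all_classical all_reals all_analysis.
From mathcomp Require complex.
Import complex.ComplexField.
Set Implicit Arguments. Unset Strict Implicit. Unset Printing Implicit Defensive.
Import Order.TTheory GRing.Theory Num.Theory.
Import numFieldNormedType.Exports.
Local Open Scope classical_set_scope.
Local Open Scope ring_scope.

Section Defs.
Variable R : realType.

(* The complex plane, as a measurable/topological space: R * R with the
   product sigma-algebra (= Borel sets of C) and the product topology. *)
Definition plane := (R * R)%type.

Definition toC (z : plane) : complex.complex R := complex.Complex z.1 z.2.

Definition cabs (c : complex.complex R) : R :=
  Num.sqrt (complex.Re c ^+ 2 + complex.Im c ^+ 2).

Definition logkern (z w : plane) : \bar R :=
  if z == w then +oo%E else (- ln (cabs (toC z - toC w)))%:E.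

Definition energy (mu : probability plane R) : \bar R :=
  (\int[mu]_z \int[mu]_w logkern z w)%E.

Definition supported_on (K : set plane) (mu : probability plane R) : Prop :=
  mu (~` K) = 0%E.

Definition robin (K : set plane) : \bar R :=
  ereal_inf [set energy mu | mu in [set mu | supported_on K mu]].

Definition polar (K : set plane) : Prop := robin K = +oo%E.

Definition Cap (K : set plane) : R :=
  match robin K with
  | r%:E => expR (- r)
  | _ => 0   (* V(K) = +oo: polar; V(K) = -oo never happens for compact K *)
  end.

(* equilibrium measure: a probability measure on K minimizing the energy
   (it exists and is unique when K is compact and non-polar) *)
Definition equilibrium_measure (K : set plane) (mu : probability plane R) :
  Prop := supported_on K mu /\ energy mu = robin K.

(* Iterated integral against mu 0, ..., mu (k-1):
   iterint mu k f z = \int[mu (k-1)] ... \int[mu 0] f (z with coords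
   0..k-1 replaced) ; for the product measure mu 0 (x) ... (x) mu (n-1)
   this is the integral of f (Fubini-Tonelli). *)
Fixpoint iterint (mu : nat -> probability plane R) (k : nat)
  (f : (nat -> plane) -> \bar R) (z : nat -> plane) : \bar R :=
  match k with
  | 0 => f z
  | k'.+1 => (\int[mu k']_w iterint mu k' f (fun i => if i == k' then w else z i))%E
  end.

Definition multi_index (n : nat) (m : nat -> nat) :=
  {dffun forall j : 'I_n, 'I_(m j).+1}.

Definition peval (n : nat) (m : nat -> nat) (a : multi_index n m -> int)
  (z : nat -> plane) : complex.complex R :=
  \sum_(k : multi_index n m)
     (a k)%:~R * \prod_(j < n) toC (z j) ^+ (k j : nat).

Definition logabs (c : complex.complex R) : \bar R :=
  if cabs c == 0 then -oo%E else (ln (cabs c))%:E.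

Definition mahler (mu : nat -> probability plane R) (n : nat) (m : nat -> nat)
  (a : multi_index n m -> int) : \bar R :=
  expeR (iterint mu n (fun z => logabs (peval a z)) (fun _ => (0, 0))).

End Defs.

(* Main.v *)
Require Import Defs.
From HB Require Import structures.
From mathcomp Require Import all_boot all_order all_algebra.
From mathcomp Require Import all_classical all_reals all_analysis.
From mathcomp Require complex.
From mathcomp Require Import measurable_realfun ring lra.
Set Implicit Arguments. Unset Strict Implicit. Unset Printing Implicit Defensive.
Import Order.TTheory GRing.Theory Num.Theory.
Import numFieldNormedType.Exports.
Local Open Scope classical_set_scope.
Local Open Scope ring_scope.

(** By Frostman's theorem the potential of the equilibrium measure of [K_j] is
    at most Robin's constant at every point of the plane, so factoring a
    polynomial [p] of degree [d] over the complex numbers gives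
    [\int log |p| dmu_j >= log |lead_coef p| + d log Cap(K_j)].  Integrating one
    variable after the other and extracting each time the coefficient of the
    highest power present, one is left with a nonzero integer, whose logarithm
    is nonnegative, plus [\sum_j d_j log Cap(K_j)] with [d_j <= m_j].

    Frostman's theorem is proved by elementary means.  Increasing the density
    of [mu] on a set [B] cannot decrease the energy; this forces the potential
    to be at most Robin's constant almost everywhere.  To reach every point,
    truncate the kernel at a level [L] and add a small multiple of [|w|^2] to
    the truncated potential.  A near-maximum of this function cannot be far from
    the set [S] where the potential is at most Robin's constant, because the
    truncated potential almost has the mean value property over the four
    points [w + r i^k] there; and near a point of [S] the truncated potential
    is controlled by the potential at that point. *)

(** * Euclidean distance on the plane *)

Section Distance.
Import complex complex.ComplexField.
Context {R : realType}.
Implicit Types z w : plane R.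

Definition pdist z w : R := cabs (toC z - toC w).

Lemma cabsE (c : complex.complex R) : cabs c = Normc.normc c.
Proof. by case: c. Qed.

Lemma cabsM (c d : complex.complex R) : cabs (c * d) = cabs c * cabs d.
Proof. by rewrite !cabsE Normc.normcM. Qed.

Lemma cabs_eq0 (c : complex.complex R) : (cabs c == 0) = (c == 0).
Proof.
rewrite cabsE; apply/eqP/eqP => [/Normc.eq0_normc//|->].
exact: Normc.normc0.
Qed.

Lemma cabs_ge0 (c : complex.complex R) : 0 <= cabs c.
Proof. exact: sqrtr_ge0. Qed.

Lemma pdist_ge0 z w : 0 <= pdist z w.
Proof. exact: cabs_ge0. Qed.

Lemma pdistE z w : pdist z w = Num.sqrt ((z.1 - w.1) ^+ 2 + (z.2 - w.2) ^+ 2).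
Proof. by []. Qed.

Lemma sqr_pdist z w : pdist z w ^+ 2 = (z.1 - w.1) ^+ 2 + (z.2 - w.2) ^+ 2.
Proof. by rewrite pdistE sqr_sqrtr// addr_ge0// sqr_ge0. Qed.

Lemma pdistC z w : pdist z w = pdist w z.
Proof. by rewrite !pdistE -sqrrN opprB -[X in _ + X]sqrrN opprB. Qed.

Lemma pdist_triangle z w v : pdist z v <= pdist z w + pdist w v.
Proof.
rewrite /pdist -(subrKA (toC w)) !cabsE.
exact: le_normcD.
Qed.

Lemma pdist_eq0 z w : (pdist z w == 0) = (z == w).
Proof.
rewrite /pdist cabs_eq0 subr_eq0.
by case: z w => [x y] [x' y']; apply/eqP/eqP => -[-> ->].
Qed.

Lemma pdist_ge_norm1 z w : `|z.1 - w.1| <= pdist z w.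
Proof.
rewrite -(@ler_pXn2r _ 2)// ?nnegrE ?pdist_ge0//.
by rewrite sqr_pdist real_normK ?num_real// lerDl sqr_ge0.
Qed.

Lemma pdist_ge_norm2 z w : `|z.2 - w.2| <= pdist z w.
Proof.
rewrite -(@ler_pXn2r _ 2)// ?nnegrE ?pdist_ge0//.
by rewrite sqr_pdist real_normK ?num_real// lerDr sqr_ge0.
Qed.

Lemma pdist_le_norm z w : pdist z w <= `|z.1 - w.1| + `|z.2 - w.2|.
Proof.
rewrite -(@ler_pXn2r _ 2)// ?nnegrE ?pdist_ge0 ?addr_ge0//.
rewrite sqr_pdist [leRHS]sqrrD !real_normK ?num_real// addrAC lerDl.
by rewrite mulrn_wge0// mulr_ge0.
Qed.

Lemma measurable_sqrt : measurable_fun [set: R] (@Num.sqrt R).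
Proof. by apply: continuous_measurable_fun; exact: sqrt_continuous. Qed.

Lemma measurable_pdist d (T : measurableType d) (f g : T -> plane R) :
  measurable_fun setT f -> measurable_fun setT g ->
  measurable_fun setT (fun x => pdist (f x) (g x)).
Proof.
move=> mf mg; apply: (measurableT_comp measurable_sqrt).
apply: measurable_funD; apply: measurable_funX; apply: measurable_funB.
- exact: (measurableT_comp measurable_fst mf).
- exact: (measurableT_comp measurable_fst mg).
- exact: (measurableT_comp measurable_snd mf).
- exact: (measurableT_comp measurable_snd mg).
Qed.

(* The points [w + r i^k], up to order *)
Definition cross (w : plane R) (r : R) (k : 'I_4) : plane R :=
  nth w [:: (w.1 + r, w.2); (w.1 - r, w.2); (w.1, w.2 + r); (w.1, w.2 - r)] k.

(* [|zeta^4 - r^4| <= |zeta|^4 + r^4] with [zeta = z - w] *)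
Lemma prod_pdist_cross z w r :
  \prod_(k < 4) pdist z (cross w r k) <= pdist z w ^+ 4 + r ^+ 4.
Proof.
rewrite -(@ler_pXn2r _ 2)// ?nnegrE ?prodr_ge0//; last 2 first.
- by move=> k _; exact: pdist_ge0.
- by rewrite addr_ge0 ?exprn_even_ge0.
rewrite -prodrXl !big_ord_recr big_ord0 /= mul1r !sqr_pdist /=.
rewrite (_ : pdist z w ^+ 4 = (pdist z w ^+ 2) ^+ 2); last by rewrite -exprM.
rewrite sqr_pdist.
set x := z.1; set y := z.2; set a := w.1; set b := w.2.
set u := x - a; set v := y - b.
rewrite [x - (a + r)](_ : _ = u - r); last by rewrite /u; ring.
rewrite [x - (a - r)](_ : _ = u + r); last by rewrite /u; ring.
rewrite [y - (b + r)](_ : _ = v - r); last by rewrite /v; ring.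
rewrite [y - (b - r)](_ : _ = v + r); last by rewrite /v; ring.
rewrite -subr_ge0.
rewrite [leRHS](_ : _ = (2 * r ^+ 2 * (u ^+ 2 - v ^+ 2)) ^+ 2); last by ring.
exact: sqr_ge0.
Qed.

End Distance.

(** * The logarithmic kernel, cut off at distance [D] and truncated at level [L] *)

Section Kernels.
Context {R : realType}.
Implicit Types D L t r tau : R.

(* [ln^+ (D / t)], with its limit [+oo] at [t = 0] where [ln] has a junk value *)
Definition lker D t : \bar R :=
  if t == 0 then +oo%E else (Num.max 0 (ln D - ln t))%:E.

(* [lker] truncated at the level [L], that is at the distance [D * expR (- L)] *)
Definition tker D L t : R :=
  if t == 0 then L else Num.min L (Num.max 0 (ln D - ln t)).

Lemma lker_ge0 D t : (0 <= lker D t)%E.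
Proof. by rewrite /lker; case: ifP => // _; rewrite lee_fin le_max lexx. Qed.

Lemma tker_ge0 D L t : 0 <= L -> 0 <= tker D L t.
Proof.
by move=> L0; rewrite /tker; case: ifP => // _; rewrite le_min L0 le_max lexx.
Qed.

Lemma tker_le_level D L t : tker D L t <= L.
Proof. by rewrite /tker; case: ifP => // _; rewrite ge_min lexx. Qed.

Lemma tker_homo D t : {homo tker D ^~ t : L L' / L <= L'}.
Proof.
move=> L L' LL'; rewrite /tker; case: ifP => // _.
by rewrite le_min ge_min LL' /= ge_min lexx orbT.
Qed.

Lemma cvg_tker D t : (tker D n%:R t)%:E @[n --> \oo] --> lker D t.
Proof.
rewrite /tker /lker; case: ifP => _.
  by apply/cvgeryP; exact: cvgr_idn.
apply: cvg_near_cst; near=> n; congr EFin; apply/min_idPr.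
by near: n; exact: nbhs_infty_ger.
Unshelve. all: by end_near. Qed.

Lemma ler_lnW (x y : R) : 0 < x -> x <= y -> ln x <= ln y.
Proof. by move=> x0 xy; rewrite ler_ln ?posrE// (lt_le_trans x0). Qed.

Lemma ln_scaleN D L : 0 < D -> ln (D * expR (- L)) = ln D - L.
Proof. by move=> D0; rewrite lnM ?posrE ?expR_gt0// expRK. Qed.

(** For [m <= t] the kernel decreases with the distance. For [m] below the truncation distance, [L]
    itself is at most [ln D - ln m]. *)
Lemma tker_le D L t (m : R) : 0 < m -> m <= D -> 
  m <= t \/ m <= D * expR (- L) -> tker D L t <= ln D - ln m.
Proof.
move=> m0 mD H.
have mm : 0 <= ln D - ln m by rewrite subr_ge0 ler_lnW.
rewrite /tker; case: H => [mt|mL].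
  rewrite gt_eqF ?(lt_le_trans m0)// ge_min ge_max mm lerB// ?orbT//.
  exact: ler_lnW.
have D0 : 0 < D by apply: lt_le_trans mD.
have LL : L <= ln D - ln m.
  by have := ler_lnW m0 mL; rewrite ln_scaleN//; lra.
by case: ifP => // _; rewrite ge_min LL.
Qed.

Lemma tkerE D L t : 0 < D -> D * expR (- L) <= t -> t <= D ->
  tker D L t = ln D - ln t.
Proof.
move=> D0 Lt tD.
have d0 : 0 < D * expR (- L) by rewrite mulr_gt0 ?expR_gt0.
have t0 : 0 < t by apply: lt_le_trans Lt.
rewrite /tker gt_eqF//.
have -> : Num.max 0 (ln D - ln t) = ln D - ln t.
  by apply/max_idPr; rewrite subr_ge0 ler_lnW.
by apply/min_idPr; have := ler_lnW d0 Lt; rewrite ln_scaleN//; lra.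
Qed.

Lemma lkerE D t : 0 < t -> t <= D -> lker D t = (ln D - ln t)%:E.
Proof.
move=> t0 tD; rewrite /lker gt_eqF//; congr EFin; apply/max_idPr.
by rewrite subr_ge0 ler_lnW.
Qed.

Lemma expRN_small D (c : R) : 0 < D -> 0 < c ->
  exists L0, forall L, L0 <= L -> D * expR (- L) <= c.
Proof.
move=> D0 c0; exists (ln D - ln c) => L LL.
rewrite -ler_ln ?posrE ?mulr_gt0 ?expR_gt0// ln_scaleN//; lra.
Qed.

(** If [t >= eta], a shift by twice the truncation distance multiplies [t] by at most [1 + tau]. If
    [t < eta], it costs at most [ln 3], which is at most [tau] times the kernel at [t'], since [t']
    is then small. *)
Lemma tker_near D tau : 0 < D -> 0 < tau ->
  exists L0, forall L, 0 <= L -> L0 <= L -> forall t t', 0 <= t -> 0 <= t' ->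
    t' <= t + 2 * (D * expR (- L)) ->
    ((tker D L t)%:E <= (1 + tau)%:E * lker D t' + tau%:E)%E.
Proof.
move=> D0 tau0.
(* Chosen so that [ln D - ln (3 * eta) = ln 3 / tau]: the kernel at any [t' <= 3 * eta] is at least
   [ln 3 / tau]. *)
pose eta := D / 3 * expR (- (ln 3 / tau)).
have eta0 : 0 < eta by rewrite mulr_gt0 ?expR_gt0 ?divr_gt0.
have ln3 : 0 < ln 3 :> R by rewrite ln_gt0// ltr1n.
have etaD : eta <= D / 3.
  rewrite ler_piMr ?divr_ge0 ?(ltW D0)// -[leRHS]expR0 ler_expR.
  by rewrite oppr_le0 divr_ge0 ?(ltW tau0) ?(ltW ln3).
have leta : ln eta = ln D - ln 3 - ln 3 / tau.
  by rewrite ln_scaleN ?divr_gt0// ln_div ?posrE.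
(* The first bound gives [2 * delta <= tau * eta], for the case [t >= eta]; the second gives
   [Num.max t delta <= eta], for the case [t < eta]. *)
have c0 : 0 < Num.min (tau * eta / 2) eta.
  by rewrite lt_min eta0 andbT divr_gt0// mulr_gt0.
have [L0 HL0] := expRN_small D0 c0.
exists L0 => L L_ge0 /HL0{HL0}.
set delta := D * expR (- L).
have delta0 : 0 < delta by rewrite mulr_gt0 ?expR_gt0.
rewrite le_min => /andP[dtau deta] t t' t0 t'0 tt'.
rewrite /lker; have [_|t'neq0] := eqVneq t' 0.
  by rewrite gt0_muley ?addye ?leey// lte_fin addr_gt0.
have {t'neq0}t'0 : 0 < t' by rewrite lt_neqAle eq_sym t'neq0.
rewrite -EFinM -EFinD lee_fin.
set y := Num.max _ _.
have y0 : 0 <= y by rewrite le_max lexx.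
have yt' : ln D - ln t' <= y by rewrite le_max lexx orbT.
have tauy0 : 0 <= tau * y by rewrite mulr_ge0 ?(ltW tau0).
have [Dt|tD] := leP D t.
  have := @tker_le D L t D D0 (lexx _) (or_introl Dt); lra.
have [etat|teta] := leP eta t.
  have tt0 : 0 < t by apply: lt_le_trans etat.
  have := @tker_le D L t t tt0 (ltW tD) (or_introl (lexx _)).
  have t't : t' <= t * (1 + tau).
    have : tau * eta <= tau * t by rewrite ler_wpM2l// ltW.
    lra.
  have := ler_lnW t'0 t't; rewrite lnM ?posrE ?addr_gt0//.
  have : ln (1 + tau) <= tau by apply: le_ln1Dx; lra.
  lra.
pose m := Num.max t delta.
have m0 : 0 < m by rewrite lt_max delta0 orbT.
have meta : m <= eta by rewrite ge_max (ltW teta).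
have mD : m <= D by lra.
have := @tker_le D L t m m0 mD.
have mm : m <= t \/ m <= delta.
  rewrite /m; case: (leP t delta) => _; [by right|by left].
move=> /(_ mm).
have t'm : t' <= 3 * m.
  have : t <= m by rewrite le_max lexx.
  have : delta <= m by rewrite le_max lexx orbT.
  lra.
have t'eta : t' <= 3 * eta by lra.
have := ler_lnW t'0 t'm; rewrite lnM ?posrE//.
have := ler_lnW t'0 t'eta; rewrite lnM ?posrE//.
rewrite leta.
have : ln 3 / tau <= y -> ln 3 <= tau * y by rewrite ler_pdivrMr// mulrC.
move=> H1 H2 H3 H4.
have : ln 3 / tau <= y by lra.
by move/H1 => H5; lra.
Qed.

(** In this range neither cutoff is active, so the logarithm turns the product inequality into one
    between sums. Writing [t ^+ 4 + r ^+ 4] as [t ^+ 4 * (1 + (r / t) ^+ 4)], the error comes from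
    [ln (1 + x) <= x]. *)
Lemma tker_cross D L t r (s : 'I_4 -> R) : 0 < D ->
  D * expR (- L) <= t -> t <= D -> 0 <= r ->
  (forall k, D * expR (- L) <= s k <= D) ->
  \prod_(k < 4) s k <= t ^+ 4 + r ^+ 4 ->
  4 * tker D L t <= \sum_(k < 4) tker D L (s k) + (r / (D * expR (- L))) ^+ 4.
Proof.
move=> D0; set delta := D * expR (- L).
have d0 : 0 < delta by rewrite mulr_gt0 ?expR_gt0.
move=> dt tD r0 sD sprod.
have t0 : 0 < t by apply: lt_le_trans dt.
have s0 k : 0 < s k by have /andP[+ _] := sD k; apply: lt_le_trans.
rewrite tkerE// (eq_bigr (fun k => ln D - ln (s k))); last first.
  by move=> k _; have /andP[? ?] := sD k; rewrite tkerE.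
have prod0 : 0 < \prod_(k < 4) s k by exact: prodr_gt0.
have lnprod : ln (\prod_(k < 4) s k) = \sum_(k < 4) ln (s k).
  rewrite !big_ord_recr !big_ord0 /= mul1r add0r.
  by rewrite !lnM ?posrE ?mulr_gt0.
have rt : (r / t) ^+ 4 <= (r / delta) ^+ 4.
  rewrite ler_pXn2r// ?nnegrE ?divr_ge0 ?(ltW d0) ?(ltW t0)//.
  by rewrite ler_wpM2l// lef_pV2 ?posrE.
have e : t ^+ 4 + r ^+ 4 = t ^+ 4 * (1 + (r / t) ^+ 4).
  by rewrite mulrDr mulr1 expr_div_n mulrCA divff ?mulr1 ?expf_neq0 ?gt_eqF.
have rt0 : 0 <= (r / t) ^+ 4 by rewrite exprn_ge0// divr_ge0// ltW.
have := ler_lnW prod0 sprod.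
rewrite lnprod e lnM ?posrE ?exprn_gt0//; last by lra.
rewrite lnXn// => H.
have : ln (1 + (r / t) ^+ 4) <= (r / t) ^+ 4 by apply: le_ln1Dx; lra.
rewrite sumrB sumr_const card_ord.
lra.
Qed.

Lemma measurable_lker D d (T : measurableType d) (f : T -> R) :
  measurable_fun setT f -> measurable_fun setT (lker D \o f).
Proof.
move=> mf; apply: measurable_fun_ifT.
- exact: measurable_fun_eqr.
- exact: measurable_cst.
- apply/measurable_EFinP; apply: measurable_maxr; first exact: measurable_cst.
  apply: measurable_funB; first exact: measurable_cst.
  exact: (measurableT_comp (@measurable_ln R) mf).
Qed.

Lemma measurable_tker D L d (T : measurableType d) (f : T -> R) :
  measurable_fun setT f -> measurable_fun setT (tker D L \o f).
Proof.
move=> mf; apply: measurable_fun_ifT.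
- exact: measurable_fun_eqr.
- exact: measurable_cst.
- apply: measurable_minr; first exact: measurable_cst.
  apply: measurable_maxr; first exact: measurable_cst.
  apply: measurable_funB; first exact: measurable_cst.
  exact: (measurableT_comp (@measurable_ln R) mf).
Qed.

End Kernels.

(** * Borel measurability of open and compact sets of the plane *)

Section PlaneSets.
Context {R : realType}.

(** An open set is the union of the squares with rational centre and radius [1 / (n + 1)] that it
    contains, and these are countably many products of intervals. *)
Lemma open_measurable_plane (U : set (plane R)) : open U -> measurable U.
Proof.
move=> oU.
pose B (i : rat * rat * nat) : set (plane R) :=
  ball (ratr i.1.1 : R) (i.2.+1%:R^-1) `*` ball (ratr i.1.2 : R) (i.2.+1%:R^-1).
have -> : U = \bigcup_i (if pselect (B i `<=` U) then B i else set0).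
  apply/seteqP; split => [z Uz|z [i _]]; last first.
    by case: pselect => //= BU; exact: BU.
  have : nbhs z U by exact: open_nbhs_nbhs.
  move=> /nbhs_ballP[e /= e0 eU].
  have [n ne] : exists n, n.+1%:R^-1 < e / 2 :> R.
    have e20 : 0 < e / 2 by rewrite divr_gt0.
    by have [N _ /(_ N (leqnn N))] := near_infty_natSinv_lt (PosNum e20); exists N.
  have d0 : 0 < n.+1%:R^-1 :> R by rewrite invr_gt0 ltr0n.
  set d : R := n.+1%:R^-1 in ne d0.
  have [q1 q1P] : exists q, ratr q \in `]z.1 - d, z.1[.
    by apply: rat_in_itvoo; lra.
  have [q2 q2P] : exists q, ratr q \in `]z.2 - d, z.2[.
    by apply: rat_in_itvoo; lra.
  have close (x y : R) : y \in `]x - d, x[ -> `|x - y| < d.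
    by rewrite in_itv /= => /andP[? ?]; rewrite ltr_norml; lra.
  exists ((q1, q2), n) => //; case: pselect => [BU|] /=.
    by split; rewrite /ball /= -/d distrC; exact: close.
  case; move=> w [/= w1 w2]; apply: eU; split; rewrite /ball /=.
    have := ler_distD (ratr q1) z.1 w.1.
    by move: w1 (close _ _ q1P); rewrite /ball /= -/d; lra.
  have := ler_distD (ratr q2) z.2 w.2.
  by move: w2 (close _ _ q2P); rewrite /ball /= -/d; lra.
apply: countable_bigcupT_measurable => [|i]; first exact: countableP.
case: pselect => BU; last exact: measurable0.
by apply: measurableX; apply: measurable_ball.
Qed.

Lemma compact_measurable_plane (K : set (plane R)) : compact K -> measurable K.
Proof.
move=> /(compact_closed (@norm_hausdorff _ (R * R)%type)) cK.
rewrite -[K]setCK; apply: measurableC; apply: open_measurable_plane.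
exact: closed_openC.
Qed.

Lemma compact_bounded_plane (K : set (plane R)) : compact K ->
  exists2 B, 0 <= B & forall z, K z -> `|z.1| <= B /\ `|z.2| <= B.
Proof.
move=> /(@compact_bounded _ (R * R)%type)[M [_ HM]].
exists (`|M| + 1); first by rewrite addr_ge0.
move=> z Kz; have := HM (`|M| + 1).
have MM : M < `|M| + 1 by rewrite (le_lt_trans (ler_norm _))// ltrDl.
move=> /(_ MM z Kz).
change (Num.max `|z.1| `|z.2| <= `|M| + 1 ->
  `|z.1| <= `|M| + 1 /\ `|z.2| <= `|M| + 1).
by rewrite ge_max => /andP[].
Qed.

End PlaneSets.

(** * Complements on integrals of extended real functions *)

Section Integrals.
Context d (T : measurableType d) (R : realType).
Local Open Scope ereal_scope.

(* Measurability is not needed: the integral of a nonnegative function is a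
   supremum over the simple functions below it. *)
Lemma le_integralT (mu : {measure set T -> \bar R}) (f g : T -> \bar R) :
  (forall x, f x <= g x) -> \int[mu]_x f x <= \int[mu]_x g x.
Proof.
move=> fg; rewrite integralE [leRHS]integralE; apply: leeB.
- rewrite !ge0_integralTE//; apply: ereal_sup_le => _ [h hf <-].
  exists h => // x; apply: le_trans (hf x) _.
  by rewrite !funeposE ge_max !le_max fg lexx orbT.
- rewrite !ge0_integralTE//; apply: ereal_sup_le => _ [h hf <-].
  exists h => // x; apply: le_trans (hf x) _.
  by rewrite !funenegE ge_max !le_max leeN2 fg lexx orbT.
Qed.

Import HBNNSimple.

(** Checked on simple functions, level set by level set, and extended by monotone convergence. *)
Lemma ge0_integral_mrestr (mu : {measure set T -> \bar R}) (B : set T)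
    (mB : measurable B) (f : T -> \bar R) :
  measurable_fun setT f -> (forall x, 0 <= f x) ->
  \int[mrestr mu mB]_x f x = \int[mu]_(x in B) f x.
Proof.
move=> mf f0; pose f_ := nnsfun_approx measurableT mf.
have f_cvg x : (f_ n x)%:E @[n --> \oo] --> f x by exact: cvg_nnsfun_approx.
have f_nd x : {homo (fun n => (f_ n x)%:E) : a b / (a <= b)%N >-> a <= b}.
  by move=> a b ab; rewrite lee_fin; exact/lefP/nd_nnsfun_approx.
have lim_f (m : {measure set T -> \bar R}) (D : set T) : measurable D ->
    \int[m]_(x in D) f x = limn (fun n => \int[m]_(x in D) (f_ n x)%:E).
  move=> mD; rewrite -monotone_convergence//=.
  - by apply: eq_integral => x _; apply/esym/cvg_lim.
  - by move=> n; apply/measurable_EFinP; exact: measurable_funTS.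
  - by move=> n x _; rewrite lee_fin.
rewrite !lim_f//; congr (limn _); apply/funext => n.
rewrite !integral_nnsfun// patch_setT mrestrict !sintegralET.
(* The value 0 is set apart: the function extended by 0 also takes it on the whole complement of
   [B]. *)
apply: eq_fsbigr => r _ /=; have [->|r0] := eqVneq r 0%R; first by rewrite !mul0e.
congr (_ * _); rewrite /mrestr; congr (mu _); rewrite -mrestrict.
apply/seteqP; split => x /=; rewrite /patch.
  by move=> [<- Bx]; rewrite mem_set.
by case: ifPn => [/set_mem//|_ /esym/eqP]; rewrite (negbTE r0).
Qed.

(** The integral of [g] may be infinite, so the integrable case of linearity does not cover this.
    With [f = g - C], the nonnegative functions [f^\+ + C] and [g + f^\-] coincide, and the integral
    of [f^\-] is at most [C], hence can be cancelled. *)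
Lemma integral_subr_cst (P : probability T R) (g : T -> \bar R) (C : R) :
  (0 <= C)%R -> measurable_fun setT g -> (forall x, 0 <= g x) ->
  \int[P]_x (g x - C%:E) = \int[P]_x g x - C%:E.
Proof.
move=> C0 mg g0; pose f x := g x - C%:E.
have mf : measurable_fun setT f.
  by apply: emeasurable_funB => //; exact: measurable_cst.
have cstC : \int[P]_x (cst C%:E x) = C%:E.
  by rewrite integral_cst// -[RHS]mule1; congr (_ * _); exact: probability_setT.
have key : \int[P]_x f^\+ x + C%:E = \int[P]_x g x + \int[P]_x f^\- x.
  rewrite -cstC -!ge0_integralD//; last first.
  - exact: measurable_funepos.
  - exact: measurable_funeneg.
  apply: eq_integral => x _; rewrite funeposE funenegE /f.
  case: (g x) (g0 x) => [r|//|//]; rewrite ?lee_fin => r0.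
  - rewrite -EFinD -EFinN -!EFin_max -!EFinD; congr EFin.
    by rewrite /Order.max; case: ltP => ?; case: ltP => ?; lra.
  - by rewrite [X in maxe X]addye// [- +oo]/= maxye maxNye addye.
have neg_fin : \int[P]_x f^\- x \is a fin_num.
  rewrite ge0_fin_numE; last exact: integral_ge0.
  apply: le_lt_trans (_ : C%:E < +oo); last by rewrite ltry.
  rewrite -[leRHS]cstC; apply: le_integralT => y; rewrite funenegE /f [cst _ _]/=.
  rewrite ge_max lee_fin C0 andbT oppeB ?fin_num_adde_defl//.
  by rewrite -[leRHS]add0e leeD2r// leeNl oppe0.
rewrite -[LHS]/(\int[P]_x f x) integralE.
rewrite -[X in X - _](@addeK _ C%:E)// key.
by rewrite addeAC addeK.
Qed.

End Integrals.

(** * Potentials and energies *)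

Section Potential.
Context {R : realType}.
Implicit Types (mu : probability (plane R) R) (D : R) (K : set (plane R)).

Definition lpot D mu (w : plane R) : \bar R :=
  (\int[mu]_z lker D (pdist z w))%E.

Lemma supported_ae K mu : measurable K -> supported_on K mu ->
  \forall z \ae mu, K z.
Proof.
move=> mK muK; exists (~` K); split => //; exact: measurableC.
Qed.

Lemma lpot_ge0 D mu w : (0 <= lpot D mu w)%E.
Proof. by apply: integral_ge0 => z _; exact: lker_ge0. Qed.

Lemma measurable_lker_pdistl D (w : plane R) :
  measurable_fun setT (fun z : plane R => lker D (pdist z w)).
Proof.
apply: (@measurable_lker _ D _ _ (fun z : plane R => pdist z w)).
exact: measurable_pdist.
Qed.

Lemma measurable_lker_pdist D :
  measurable_fun setT (fun p : plane R * plane R => lker D (pdist p.1 p.2)).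
Proof.
apply: (@measurable_lker _ D _ _ (fun p : plane R * plane R => pdist p.1 p.2)).
exact: measurable_pdist.
Qed.

Lemma measurable_lpot D mu : measurable_fun setT (lpot D mu).
Proof.
rewrite (_ : lpot D mu =
    fubini_F mu (fun p => lker D (pdist p.1 p.2))); last first.
  by apply/funext => w; apply: eq_integral => z _; rewrite pdistC.
apply: measurable_fun_fubini_tonelli_F; first exact: measurable_lker_pdist.
by move=> p; exact: lker_ge0.
Qed.

Lemma logkern_pdist (z w : plane R) : logkern z w =
  if pdist z w == 0 then +oo%E else (- ln (pdist z w))%:E.
Proof. by rewrite /logkern pdist_eq0. Qed.

Lemma measurable_logkern :
  measurable_fun setT (fun p : plane R * plane R => logkern p.1 p.2).
Proof.
have mp : measurable_fun setT (fun p : plane R * plane R => pdist p.1 p.2).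
  exact: measurable_pdist.
rewrite (_ : (fun p => _) = fun p : plane R * plane R =>
    if pdist p.1 p.2 == 0 then +oo%E else (- ln (pdist p.1 p.2))%:E); last first.
  by apply/funext => p; exact: logkern_pdist.
apply: measurable_fun_ifT.
- exact: measurable_fun_eqr.
- exact: measurable_cst.
- apply/measurable_EFinP; apply: measurable_funN.
  exact: (measurableT_comp (@measurable_ln R) mp).
Qed.

(** Up to the constant [ln D], the logarithmic kernel becomes nonnegative on bounded sets, which
    gives access to Tonelli's theorem. *)
Lemma logkernE D (z w : plane R) : 1 <= D -> pdist z w <= D ->
  logkern z w = (lker D (pdist z w) - (ln D)%:E)%E.
Proof.
move=> D1 zwD; rewrite logkern_pdist.
case: ifPn => [/eqP->|zw]; first by rewrite /lker eqxx.
rewrite lkerE// ?lt_neqAle ?pdist_ge0 ?andbT 1?eq_sym//.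
by rewrite -EFinB; congr EFin; ring.
Qed.

Lemma measurable_integral_logkern mu :
  measurable_fun setT (fun z => (\int[mu]_w logkern z w)%E).
Proof.
rewrite (_ : (fun z => _) =
  (fubini_F mu ((fun p : plane R * plane R => logkern p.1 p.2)^\+) \-
   fubini_F mu ((fun p : plane R * plane R => logkern p.1 p.2)^\-))%E); last first.
  apply/funext => z; rewrite integralE /=; congr (_ - _)%E.
    by apply: eq_integral => w _; rewrite !funeposE.
  by apply: eq_integral => w _; rewrite !funenegE.
apply: emeasurable_funB; apply: measurable_fun_fubini_tonelli_F => //.
  by apply: measurable_funepos; exact: measurable_logkern.
by apply: measurable_funeneg; exact: measurable_logkern.
Qed.

(** Almost every pair of points lies in [K], where the two kernels differ by [ln D]; as [mu] has
    mass one, this constant passes unchanged through both integrals. *)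
Lemma energy_lpot D K mu : 1 <= D -> measurable K -> supported_on K mu ->
  (forall z w, K z -> K w -> pdist z w <= D) ->
  energy mu = (\int[mu]_z lpot D mu z - (ln D)%:E)%E.
Proof.
move=> D1 mK muK KD.
have aeK := supported_ae mK muK.
have lnD0 : 0 <= ln D by exact: ln_ge0.
rewrite -integral_subr_cst//; last 2 first.
- exact: measurable_lpot.
- by move=> z; exact: lpot_ge0.
rewrite /energy; apply: ae_eq_integral => //.
- exact: measurable_integral_logkern.
- by apply: emeasurable_funB; [exact: measurable_lpot|exact: measurable_cst].
apply: (filterS _ aeK) => z Kz _ /=.
rewrite -integral_subr_cst//; last 2 first.
- exact: measurable_lker_pdistl.
- by move=> w; exact: lker_ge0.
apply: ae_eq_integral => //.
- exact: (measurableT_comp measurable_logkern (pair1_measurable z)).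
- by apply: emeasurable_funB; [exact: measurable_lker_pdistl|exact: measurable_cst].
apply: (filterS _ aeK) => w Kw _ /=.
by rewrite (@logkernE D)//; [rewrite pdistC|exact: KD].
Qed.

End Potential.

(** * Probability measures with increased density on a set *)

Section Reweighting.
Context d (T : measurableType d) (R : realType) (mu : probability T R).
Context (B : set T) (mB : measurable B) (s : {nonneg R}).

Definition reweight_total : R := 1 + s%:num * fine (mu B).

Lemma reweight_total_gt0 : 0 < reweight_total.
Proof. by rewrite ltr_wpDr// mulr_ge0// fine_ge0. Qed.

Definition reweight_factor : {nonneg R} :=
  NngNum (ltW (divr_gt0 ltr01 reweight_total_gt0)).

(* Density proportional to [1 + s 1_B] with respect to [mu]. *)
Definition reweight : set T -> \bar R :=
  mscale reweight_factor (measure_add mu (mscale s (mrestr mu mB))).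

HB.instance Definition _ := Measure.on reweight.

Lemma reweight_setT : reweight setT = 1%E.
Proof.
rewrite (_ : reweight setT = ((1 / reweight_total)%:E *
  (mu setT + s%:num%:E * mu (setT `&` B)))%E); last first.
  by congr (_ * _)%E; exact: measure_addE.
rewrite setTI.
rewrite (_ : mu setT = 1%:E); last exact: probability_setT.
rewrite -[mu B]fineK ?fin_num_measure// -EFinM.
by rewrite div1r mulVf// gt_eqF// reweight_total_gt0.
Qed.

HB.instance Definition _ :=
  Measure_isProbability.Build _ _ _ reweight reweight_setT.

Lemma ge0_integral_reweight (f : T -> \bar R) : measurable_fun setT f ->
  (forall x, 0 <= f x)%E ->
  (\int[reweight]_x f x = (reweight_total^-1)%:E *
     (\int[mu]_x f x + s%:num%:E * \int[mu]_(x in B) f x))%E.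
Proof.
move=> mf f0; rewrite ge0_integral_mscale//= div1r; congr (_ * _)%E.
rewrite ge0_integral_measure_add//; congr (_ + _)%E.
by rewrite ge0_integral_mscale// ge0_integral_mrestr.
Qed.

End Reweighting.

(** * First variation of the energy at an equilibrium measure *)

Section Variation.
Context {R : realType}.
Implicit Types (mu : probability (plane R) R) (D : R) (K B : set (plane R)).

(** Tonelli's theorem and the symmetry of the kernel, with the restriction to [B] written as an
    indicator factor so that both integrals run over the plane. *)
Lemma integral_lpot_sym D mu B : measurable B ->
  (\int[mu]_w \int[mu]_(z in B) lker D (pdist z w) =
   \int[mu]_(z in B) lpot D mu z)%E.
Proof.
move=> mB.
have mk : measurable_fun setT (fun p : plane R * plane R =>
    lker D (pdist p.1 p.2) * (\1_B p.1)%:E)%E.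
  apply: emeasurable_funM; first exact: measurable_lker_pdist.
  apply/measurable_EFinP.
  exact: (measurableT_comp (measurable_indic mB) measurable_fst).
have ind0 (z : plane R) : (0 <= (\1_B z : R)%:E)%E by rewrite lee_fin.
transitivity (\int[mu]_w \int[mu]_z (lker D (pdist z w) * (\1_B z)%:E))%E.
  by apply: eq_integral => w _; rewrite integral_mkcond epatch_indic.
rewrite -(@fubini_tonelli _ _ _ _ R mu mu _ mk)/=; last first.
  by move=> p; rewrite mule_ge0 ?lker_ge0.
rewrite [RHS]integral_mkcond epatch_indic; apply: eq_integral => z _ /=.
rewrite ge0_integralZr//; last by move=> w _; exact: lker_ge0.
  by congr (_ * _)%E; apply: eq_integral => w _; rewrite pdistC.
by under eq_fun do rewrite pdistC; exact: measurable_lker_pdistl.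
Qed.

(* The first-order term in [s] of the energy of [reweight]. *)
Lemma quadratic_variation (V x y b : R) : 0 <= b ->
  (forall s, 0 < s -> V * (1 + s * b) ^+ 2 <= V + 2 * s * x + s ^+ 2 * y) ->
  V * b <= x.
Proof.
move=> b0 H; rewrite leNgt; apply/negP => xVb.
(* [N] exceeds [y - V * b ^+ 2], so for the [s] below the second-order term, divided by [s], is at
   most [V * b - x]: half of what the first-order term loses. *)
pose N := `|y| + `|V * b ^+ 2| + 1.
have N0 : 0 < N by rewrite ltr_wpDl// addr_ge0.
pose s := (V * b - x) / N.
have s0 : 0 < s by rewrite divr_gt0// subr_gt0.
have := H s s0; rewrite -subr_ge0.
have -> : V + 2 * s * x + s ^+ 2 * y - V * (1 + s * b) ^+ 2 =
    s * (2 * (x - V * b) + s * (y - V * b ^+ 2)) by ring.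
rewrite pmulr_rge0// => H1.
have : s * (y - V * b ^+ 2) <= s * N.
  rewrite ler_wpM2l ?(ltW s0)// /N.
  have := ler_norm y; have := ler_norm (- (V * b ^+ 2)); rewrite normrN; lra.
have sN : s * N = V * b - x by rewrite /s divfK ?gt_eqF.
rewrite sN; lra.
Qed.

Lemma integral_lpot_equilibrium K mu D V : 1 <= D -> measurable K ->
  (forall z w, K z -> K w -> pdist z w <= D) ->
  supported_on K mu -> energy mu = V%:E ->
  (\int[mu]_z lpot D mu z = (V + ln D)%:E)%E.
Proof.
move=> D1 mK KD muK; rewrite (@energy_lpot _ D K mu)//.
by move=> H; rewrite -[LHS](@subeK _ _ (ln D)%:E)// H.
Qed.

(** The reweighted measure still lives on [K], so its energy is at least Robin's constant.
    Multiplied by the squared normalizing constant, this is the hypothesis of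
    [quadratic_variation]. *)
Lemma lpot_mass_ge K mu D V B : 1 <= D -> measurable K ->
  (forall z w, K z -> K w -> pdist z w <= D) ->
  supported_on K mu -> energy mu = V%:E -> robin K = V%:E -> measurable B ->
  ((V + ln D)%:E * mu B <= \int[mu]_(z in B) lpot D mu z)%E.
Proof.
move=> D1 mK KD muK muV KV mB.
pose V' := V + ln D.
have mk w : measurable_fun setT (fun z => lker D (pdist z w)).
  exact: measurable_lker_pdistl.
have k0 w z : (0 <= lker D (pdist z w))%E by exact: lker_ge0.
have muI := integral_lpot_equilibrium D1 mK KD muK muV.
pose PB w := (\int[mu]_(z in B) lker D (pdist z w))%E.
have PB0 w : (0 <= PB w)%E by apply: integral_ge0.
have mPB : measurable_fun setT PB.
  rewrite (_ : PB = fubini_F mu (fun p => lker D (pdist p.1 p.2) * (\1_B p.2)%:E)%E).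
    apply: measurable_fun_fubini_tonelli_F.
      apply: emeasurable_funM; first exact: measurable_lker_pdist.
      apply/measurable_EFinP.
      exact: (measurableT_comp (measurable_indic mB) measurable_snd).
    by move=> p; rewrite mule_ge0 ?lker_ge0// lee_fin.
  apply/funext => w; rewrite /PB integral_mkcond epatch_indic.
  by apply: eq_integral => z _ /=; rewrite pdistC.
have PBle w : (PB w <= lpot D mu w)%E.
  by apply: ge0_subset_integral => //; exact: mk.
have mP : measurable_fun setT (lpot D mu) by exact: measurable_lpot.
have P0 w : (0 <= lpot D mu w)%E by exact: lpot_ge0.
set X := (\int[mu]_(z in B) lpot D mu z)%E.
have X0 : (0 <= X)%E by apply: integral_ge0.
have Xfin : X \is a fin_num.
  rewrite ge0_fin_numE//; apply: le_lt_trans (_ : V'%:E < +oo)%E; last by rewrite ltry.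
  by rewrite -muI; apply: ge0_subset_integral.
pose Y := (\int[mu]_(w in B) PB w)%E.
have Y0 : (0 <= Y)%E by apply: integral_ge0.
have Yfin : Y \is a fin_num.
  rewrite ge0_fin_numE//; apply: le_lt_trans (_ : X < +oo)%E; last first.
    by rewrite -ge0_fin_numE.
  by apply: ge0_le_integral => //; exact: measurable_funTS.
have muBfin : mu B \is a fin_num by exact: fin_num_measure.
rewrite -[mu B]fineK// -[X]fineK// -EFinM lee_fin.
apply: (@quadratic_variation _ _ (fine Y)); first exact: fine_ge0.
move=> s s0; pose sn := NngNum (ltW s0).
pose nu := reweight mu mB sn.
pose c := reweight_total mu B sn.
have c0 : 0 < c by exact: reweight_total_gt0.
have nuK : supported_on K nu.
  have KB0 : mu (~` K `&` B) = 0%E.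
    apply/eqP; rewrite eq_le measure_ge0 andbT -muK.
    apply: le_measure; rewrite ?inE//; [|exact: measurableC].
    by apply: measurableI => //; exact: measurableC.
  transitivity ((1 / c)%:E * (mu (~` K) + s%:E * mu (~` K `&` B)))%E.
    by congr (_ * _)%E; exact: measure_addE.
  by rewrite muK KB0 !mule0 adde0 mule0.
have : (robin K <= energy nu)%E by apply: ereal_inf_lbound; exists nu.
rewrite KV (@energy_lpot _ D K nu)//.
have lpotnu w : lpot D nu w = ((c^-1)%:E * (lpot D mu w + s%:E * PB w))%E.
  by rewrite /lpot ge0_integral_reweight.
(* Bilinear expansion of the energy in [mu] and its restriction to [B]: both mixed terms equal [X]
   by symmetry, and [Y] is the energy of the restriction. *)
have -> : (\int[nu]_z lpot D nu z =
    (c^-1)%:E * ((c^-1)%:E * (V'%:E + s%:E * X) + s%:E * ((c^-1)%:E * (X + s%:E * Y))))%E.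
  have msPB : measurable_fun setT (fun w => s%:E * PB w)%E.
    by apply: emeasurable_funM => //; exact: measurable_cst.
  have sPB0 w : (0 <= s%:E * PB w)%E by rewrite mule_ge0// lee_fin ltW.
  have mS : measurable_fun setT (fun w => lpot D mu w + s%:E * PB w)%E.
    exact: emeasurable_funD.
  have S0 w : (0 <= lpot D mu w + s%:E * PB w)%E by rewrite adde_ge0.
  have s0' : (0 <= s%:E)%E by rewrite lee_fin ltW.
  have ci0 : (0 <= (c^-1)%:E)%E by rewrite lee_fin invr_ge0 ltW.
  have intS (A : set (plane R)) : measurable A ->
      (\int[mu]_(w in A) lpot D nu w =
       (c^-1)%:E * (\int[mu]_(w in A) lpot D mu w +
                    s%:E * \int[mu]_(w in A) PB w))%E.
    move=> mA; under eq_integral do rewrite lpotnu.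
    rewrite ge0_integralZl//; last exact: measurable_funTS.
    rewrite ge0_integralD//; [|exact: measurable_funTS..].
    by rewrite ge0_integralZl//; exact: measurable_funTS.
  rewrite ge0_integral_reweight//; [|exact: measurable_lpot|by move=> w; exact: lpot_ge0].
  rewrite !intS// muI; do 4 f_equal.
  by rewrite integral_lpot_sym.
rewrite -[X]fineK// -[Y]fineK//.
rewrite -!(EFinM, EFinD, EFinB) lee_fin -/V'.
have -> : c^-1 * (c^-1 * (V' + s * fine X) + s * (c^-1 * (fine X + s * fine Y))) =
    (V' + 2 * s * fine X + s ^+ 2 * fine Y) / c ^+ 2.
  by field; rewrite gt_eqF.
rewrite lerBrDr -/V' ler_pdivlMr ?exprn_gt0//.
Qed.

(** On the set [B] where the bound holds, [lpot_mass_ge] gives an integral of at least [V' * mu B].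
    The total is exactly [V'], so the excess over [V'], which is nonnegative off [B], has integral
    zero there. *)
Lemma lpot_le_ae K mu D V : 1 <= D -> measurable K ->
  (forall z w, K z -> K w -> pdist z w <= D) ->
  supported_on K mu -> energy mu = V%:E -> robin K = V%:E ->
  \forall w \ae mu, (lpot D mu w <= (V + ln D)%:E)%E.
Proof.
move=> D1 mK KD muK muV KV; set V' := V + ln D.
have mP : measurable_fun setT (lpot D mu) by exact: measurable_lpot.
pose B := [set w | (lpot D mu w <= V'%:E)%E].
have mB : measurable B.
  by rewrite -[B]setTI; exact: emeasurable_fun_infty_c.
have mA := measurableC mB.
have muI := integral_lpot_equilibrium D1 mK KD muK muV.
have HB := @lpot_mass_ge K mu D V B D1 mK KD muK muV KV mB.
have splitI : (\int[mu]_(z in B) lpot D mu z + \int[mu]_(z in ~` B) lpot D mu z = V'%:E)%E.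
  rewrite -ge0_integral_setU ?setvU//.
  - by rewrite setUC setvU.
  - by rewrite setUC setvU.
  - by move=> z _; exact: lpot_ge0.
  - by rewrite disj_set2E setICr.
pose h w := (lpot D mu w - V'%:E)%E.
have mh : measurable_fun setT h.
  by apply: emeasurable_funB => //; exact: measurable_cst.
have h0 w : (~` B) w -> (0 <= h w)%E.
  by rewrite /B /= => /negP; rewrite -ltNge => /ltW H; rewrite sube_ge0.
have V'0 : (0 <= V'%:E)%E by rewrite -muI; apply: integral_ge0 => z _; exact: lpot_ge0.
have eqA : (\int[mu]_(z in ~` B) lpot D mu z =
    \int[mu]_(z in ~` B) h z + V'%:E * mu (~` B))%E.
  rewrite -(integral_cst _ mA) -ge0_integralD//.
  - by apply: eq_integral => z _; rewrite /h subeK.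
  - exact: measurable_funTS.
have muB : mu B \is a fin_num by exact: fin_num_measure.
have muA : (mu (~` B) = 1 - mu B)%E by exact: probability_setC.
have inth0 : (0 <= \int[mu]_(z in ~` B) h z)%E by apply: integral_ge0.
have inth : (\int[mu]_(z in ~` B) `|h z| = 0)%E.
  transitivity (\int[mu]_(z in ~` B) h z)%E.
    by apply: eq_integral => z /set_mem Az; rewrite gee0_abs// h0.
  apply/eqP; rewrite eq_le inth0 andbT.
  have aux (I J : \bar R) : (V'%:E * mu B <= I)%E -> (0 <= J)%E ->
      (I + (J + V'%:E * (1 - mu B)))%E = V'%:E -> (J <= 0)%E.
    rewrite -[mu B]fineK//; case: I J => [p| |] [q| |]//=; rewrite -!EFinM.
    by rewrite !lee_fin => pB _ [e]; lra.
  by apply: aux HB inth0 _; rewrite -muA -eqA.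
have /(ae_eq_integral_abs mu mA) := inth.
move=> /(_ (measurable_funTS mh)); apply: filterS => w hw /=.
have [//|wA] := pselect (B w).
rewrite -[leLHS](@subeK _ _ V'%:E)//.
by have := hw wA; rewrite /h => ->; rewrite add0e.
Qed.

End Variation.

(** * Truncated potentials *)

Section MaximumPrinciple.
Context {R : realType} (mu : probability (plane R) R).
Implicit Types (D L tau : R) (w z : plane R).

Definition tpot D L w : R := fine (\int[mu]_z (tker D L (pdist z w))%:E).

Lemma measurable_tker_pdistl D L w :
  measurable_fun setT (fun z : plane R => (tker D L (pdist z w))%:E).
Proof.
apply/measurable_EFinP.
apply: (@measurable_tker _ D L _ _ (fun z : plane R => pdist z w)).
exact: measurable_pdist.
Qed.

Lemma integral_cstT (c : R) : (\int[mu]_z (cst c%:E z) = c%:E)%E.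
Proof.
by rewrite integral_cst// -[RHS]mule1; congr (_ * _)%E; exact: probability_setT.
Qed.

Lemma integral_tker D L w : 0 <= L ->
  (\int[mu]_z (tker D L (pdist z w))%:E = (tpot D L w)%:E)%E.
Proof.
move=> L0; rewrite /tpot fineK// ge0_fin_numE; last first.
  by apply: integral_ge0 => z _; rewrite lee_fin tker_ge0.
apply: le_lt_trans (_ : L%:E < +oo)%E; last by rewrite ltry.
rewrite -integral_cstT; apply: le_integralT => z.
by rewrite lee_fin tker_le_level.
Qed.

Lemma tpot_le_level D L w : 0 <= L -> tpot D L w <= L.
Proof.
move=> L0; rewrite -lee_fin -integral_tker// -[leRHS]integral_cstT.
by apply: le_integralT => z; rewrite lee_fin tker_le_level.
Qed.

Lemma tpot_homo D w L L' : 0 <= L -> L <= L' -> tpot D L w <= tpot D L' w.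
Proof.
move=> L0 LL'; rewrite -lee_fin -!integral_tker ?(le_trans L0)//.
by apply: le_integralT => z; rewrite lee_fin tker_homo.
Qed.

Lemma tpot_le D L w (c : R) : 0 <= L -> 0 <= c ->
  (\forall z \ae mu, tker D L (pdist z w) <= c) -> tpot D L w <= c.
Proof.
move=> L0 c0 H; rewrite -lee_fin -integral_tker// -integral_cstT.
apply: ae_ge0_le_integral => //.
- by move=> z _; rewrite lee_fin tker_ge0.
- exact: measurable_tker_pdistl.
- by apply: filterS H => z ? _; rewrite lee_fin.
Qed.

(** Monotone convergence along the integer truncation levels. *)
Lemma lpot_le_tpot D (c : R) w :
  (forall L, 0 <= L -> tpot D L w <= c) -> (lpot D mu w <= c%:E)%E.
Proof.
move=> H.
have cvgP := @cvg_monotone_convergence _ _ _ mu setT measurableT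
  (fun n z => (tker D n%:R (pdist z w))%:E).
have limE : (\int[mu]_z limn (fun n => (tker D n%:R (pdist z w))%:E) =
             lpot D mu w)%E.
  by apply: eq_integral => z _; apply/cvg_lim => //; exact: cvg_tker.
rewrite -limE; apply: (cvge_to_le (cvgP _ _ _)).
- by move=> n; exact: measurable_tker_pdistl.
- by move=> n z _; rewrite lee_fin tker_ge0.
- by move=> z _ a b ab; rewrite lee_fin tker_homo// ler_nat.
- by apply: nearW => n; rewrite integral_tker// lee_fin H.
Qed.

Lemma tpot_near D L tau w w' (c : R) : 0 <= L -> 0 <= tau ->
  (forall z, ((tker D L (pdist z w))%:E <=
    (1 + tau)%:E * lker D (pdist z w') + tau%:E)%E) ->
  (lpot D mu w' <= c%:E)%E -> tpot D L w <= (1 + tau) * c + tau.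
Proof.
move=> L0 tau0 H Pc; rewrite -lee_fin -integral_tker//.
have mk := @measurable_lker_pdistl R D w'.
apply: le_trans (le_integralT _ H) _.
rewrite ge0_integralD//; first last.
- exact: emeasurable_funM.
- by move=> z _; rewrite mule_ge0 ?lker_ge0// lee_fin addr_ge0.
rewrite integral_cstT [leRHS]EFinD; apply: leeD2r; rewrite ge0_integralZl//.
- by rewrite EFinM lee_wpmul2l// lee_fin addr_ge0.
- by move=> z _; exact: lker_ge0.
- by rewrite lee_fin addr_ge0.
Qed.

(** Integrating the kernel inequality of [tker_cross] shows that the truncated potential at [w]
    exceeds its mean over the four points by at most [c / 4]. *)
Lemma tpot_cross D L w r (c : R) : 0 <= L -> 0 <= c ->
  (\forall z \ae mu, 4 * tker D L (pdist z w) <=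
     \sum_(k < 4) tker D L (pdist z (cross w r k)) + c) ->
  4 * tpot D L w <= \sum_(k < 4) tpot D L (cross w r k) + c.
Proof.
move=> L0 c0 H.
have t0 v z : (0 <= (tker D L (pdist z v))%:E)%E by rewrite lee_fin tker_ge0.
have mt v := @measurable_tker_pdistl D L v.
rewrite -lee_fin EFinM [leRHS]EFinD -sumEFin -integral_tker//.
under eq_bigr do rewrite -integral_tker//.
rewrite -ge0_integral_sum// -(integral_cstT c) -ge0_integralD//; first last.
- exact: emeasurable_sum.
- by move=> z _; exact: sume_ge0.
rewrite -ge0_integralZl//; apply: ae_ge0_le_integral => //.
- by move=> z _; rewrite mule_ge0.
- by apply: emeasurable_funM => //; exact: measurable_cst.
- by move=> z _; rewrite adde_ge0// sume_ge0.
- by apply: emeasurable_funD; [exact: emeasurable_sum|exact: measurable_cst].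
- by apply: filterS H => z Hz _; rewrite sumEFin -EFinM -EFinD lee_fin.
Qed.

End MaximumPrinciple.

(** * Frostman's upper bound at every point of the plane *)

Section Frostman.
Context {R : realType} (mu : probability (plane R) R).
Implicit Types (B D L V tau rho : R) (K : set (plane R)) (w z : plane R).

Definition box rho : set (plane R) := [set w | `|w.1| <= rho /\ `|w.2| <= rho].

Lemma pdist_box B rho z w : box B z -> box rho w -> pdist z w <= 2 * (B + rho).
Proof.
move=> [z1 z2] [w1 w2]; apply: le_trans (pdist_le_norm _ _) _.
have := ler_normB z.1 w.1; have := ler_normB z.2 w.2; lra.
Qed.

Lemma pdist_cross w r k : 0 <= r -> pdist (cross w r k) w = r.
Proof.
move=> r0; rewrite pdistE.
case: k => [[|[|[|[|//]]]] k4]; rewrite /cross /=;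
  [rewrite (_ : w.1 + r - w.1 = r)|rewrite (_ : w.1 - r - w.1 = - r)
  |rewrite (_ : w.2 + r - w.2 = r)|rewrite (_ : w.2 - r - w.2 = - r)];
  rewrite ?subrr ?expr0n ?addr0 ?add0r ?sqrrN ?sqrtr_sqr ?ger0_norm//; ring.
Qed.

Lemma sum_sqr_cross w r :
  \sum_(k < 4) ((cross w r k).1 ^+ 2 + (cross w r k).2 ^+ 2) =
  4 * (w.1 ^+ 2 + w.2 ^+ 2) + 4 * r ^+ 2.
Proof. by rewrite !big_ord_recr big_ord0 /=; ring. Qed.

Lemma cross_box w r k rho : 0 <= r -> r <= 1 -> box (rho - 1) w ->
  box rho (cross w r k).
Proof.
move=> r0 r1 [w1 w2].
have := pdist_ge_norm1 (cross w r k) w; have := pdist_ge_norm2 (cross w r k) w.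
rewrite !pdist_cross// => h2 h1; split.
- have := ler_normD ((cross w r k).1 - w.1) w.1; rewrite subrK; lra.
- have := ler_normD ((cross w r k).2 - w.2) w.2; rewrite subrK; lra.
Qed.

(** Such a [w] is at distance at least [expR (- V)] from [K], and at that distance the kernel is at
    most [V + ln D]. *)
Lemma tpot_le_far K B D L V rho w : 1 <= D -> 0 <= L -> 0 <= V + ln D ->
  (\forall z \ae mu, K z) -> K `<=` box B -> B + expR (- V) + 1 <= rho ->
  (forall z, K z -> pdist z w <= D) -> ~ box (rho - 1) w ->
  tpot mu D L w <= V + ln D.
Proof.
move=> D1 L0 V0 aeK KB Brho KD wbox.
apply: tpot_le => //; apply: filterS aeK => z Kz.
have [z1 z2] := KB _ Kz.
have eV : expR (- V) <= pdist z w.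
  have [w1|w1] := leP `|w.1| (rho - 1).
    have [w2|w2] := leP `|w.2| (rho - 1); first by case: wbox.
    have := pdist_ge_norm2 z w; have := ler_distD z.2 w.2 0.
    by rewrite !subr0 [`|w.2 - z.2|]distrC; lra.
  have := pdist_ge_norm1 z w; have := ler_distD z.1 w.1 0.
  by rewrite !subr0 [`|w.1 - z.1|]distrC; lra.
have := @tker_le _ D L (pdist z w) _ (expR_gt0 (- V)) _ (or_introl eV).
rewrite expRK opprK addrC; apply.
exact: le_trans eV (KD z Kz).
Qed.

(** Averaged over the cross, the quadratic term gains [eps * r ^+ 2], while the truncated potential
    loses at most a quarter of [(r / delta) ^+ 4]. Near-maximality at [w] bounds the net gain by
    [slack]. *)
Lemma tpot_max_off_mass D L eps r w slack (S : set (plane R)) :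
  1 <= D -> 0 <= L -> 0 < r -> r <= D * expR (- L) ->
  (\forall z \ae mu, S z) ->
  (forall z k, S z -> pdist z w <= D /\ pdist z (cross w r k) <= D) ->
  (forall z, S z -> 2 * (D * expR (- L)) < pdist z w) ->
  (forall k, tpot mu D L (cross w r k) +
    eps * ((cross w r k).1 ^+ 2 + (cross w r k).2 ^+ 2) <=
    tpot mu D L w + eps * (w.1 ^+ 2 + w.2 ^+ 2) + slack) ->
  4 * eps * r ^+ 2 <= 4 * slack + (r / (D * expR (- L))) ^+ 4.
Proof.
set delta := D * expR (- L) => D1 L0 r0 rd aeS SD Sfar H.
have D0 : 0 < D by lra.
have d0 : 0 < delta by rewrite mulr_gt0 ?expR_gt0.
have mean : 4 * tpot mu D L w <=
    \sum_(k < 4) tpot mu D L (cross w r k) + (r / delta) ^+ 4.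
  apply: tpot_cross => //; first by rewrite exprn_ge0// divr_ge0 ?ltW.
  apply: filterS aeS => z Sz; have zw := Sfar z Sz.
  have [zD _] := SD z ord0 Sz.
  apply: tker_cross => //; rewrite -/delta ?(ltW r0)//; first by lra.
    (* The points of the cross stay at distance more than [2 * delta - r >= delta] from [z], where
       the truncation is inactive. *)
    move=> k; have [_ ->] := SD z k Sz; rewrite andbT.
    have := pdist_triangle z (cross w r k) w.
    by rewrite pdist_cross ?(ltW r0)//; lra.
  exact: prod_pdist_cross.
have : \sum_(k < 4) (tpot mu D L (cross w r k) +
    eps * ((cross w r k).1 ^+ 2 + (cross w r k).2 ^+ 2)) <=
    \sum_(k < 4) (tpot mu D L w + eps * (w.1 ^+ 2 + w.2 ^+ 2) + slack).
  by apply: ler_sum => k _; exact: H.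
rewrite big_split /= -mulr_sumr sum_sqr_cross sumr_const card_ord.
lra.
Qed.

Lemma tpot_le_max K B D V rho tau : 1 <= D -> 0 <= V + ln D -> 0 < tau ->
  (\forall z \ae mu, K z) -> K `<=` box B -> 0 <= B ->
  B + expR (- V) + 1 <= rho ->
  (forall z w, K z -> box rho w -> pdist z w <= D) ->
  (\forall z \ae mu, (lpot D mu z <= (V + ln D)%:E)%E) ->
  exists L0, forall L w0, 0 <= L -> L0 <= L -> box rho w0 ->
  tpot mu D L w0 <= (1 + tau) * (V + ln D) + tau.
Proof.
move=> D1 V0 tau0 aeK KB B0 Brho KD aeV.
have D0 : 0 < D by lra.
have [L0 nearP] := tker_near D0 tau0; exists L0 => L w0 L_ge0 L0L w0box.
set V' := V + ln D in V0 aeV *; set M := (1 + tau) * V' + tau.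
set delta := D * expR (- L).
have d0 : 0 < delta by rewrite mulr_gt0 ?expR_gt0.
have V'M : V' <= M by rewrite /M; have := mulr_ge0 (ltW tau0) V0; lra.
have rho1 : 1 <= rho by have := expR_gt0 (- V); lra.
(* Then [eps] tends to 0. In the error, [2 * rho ^+ 2] bounds the squared modulus on the box, and
   the additional 1 absorbs the slack [kap <= eps]. *)
suff main eps : 0 < eps -> eps <= 1 ->
    tpot mu D L w0 <= M + eps * (2 * rho ^+ 2 + 1).
  set c := 2 * rho ^+ 2 + 1 in main.
  have c0 : 0 < c by rewrite ltr_wpDl// mulr_ge0// sqr_ge0.
  rewrite leNgt; apply/negP => Mt.
  pose e := Num.min 1 ((tpot mu D L w0 - M) / (2 * c)).
  have e0 : 0 < e by rewrite lt_min ltr01 divr_gt0 ?subr_gt0// mulr_gt0.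
  have := main e e0; rewrite ge_min lexx => /(_ isT).
  have : e * c <= (tpot mu D L w0 - M) / (2 * c) * c.
    by rewrite ler_wpM2r ?(ltW c0)// ge_min lexx orbT.
  rewrite invfM mulrA mulfVK ?gt_eqF//; lra.
move=> eps0 eps1.
(* [r <= 1] keeps the cross in the box, [r <= delta] keeps it outside the truncated range, and the
   last bound makes [(r / delta) ^+ 4] at most [eps * r ^+ 2]. *)
pose r := Num.min (Num.min 1 delta) (delta ^+ 2 * eps).
have r0 : 0 < r by rewrite !lt_min ltr01 d0 mulr_gt0// exprn_gt0.
have r1 : r <= 1 by rewrite !ge_min lexx.
have rd : r <= delta by rewrite !ge_min lexx orbT.
have rd2 : r <= delta ^+ 2 * eps by rewrite !ge_min lexx orbT.
(* With this slack, [tpot_max_off_mass] would give [4 * eps * r ^+ 2 <= 3 * eps * r ^+ 2], which is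
   absurd. *)
pose kap := eps * r ^+ 2 / 2.
have kap0 : 0 < kap by rewrite divr_gt0// mulr_gt0// exprn_gt0.
have kap1 : kap <= eps.
  rewrite ler_pdivrMr// ler_pM2l//.
  by apply: le_trans (_ : 1 <= 2); rewrite ?ler1n// expr_le1// ltW.
have sqbox w : box rho w -> w.1 ^+ 2 + w.2 ^+ 2 <= 2 * rho ^+ 2.
  move=> [w1 w2]; rewrite -[w.1 ^+ 2]real_normK ?num_real//.
  rewrite -[w.2 ^+ 2]real_normK ?num_real// mulr_natl mulr2n.
  by rewrite lerD// ler_pXn2r// nnegrE//; lra.
have sq0 w : 0 <= w.1 ^+ 2 + w.2 ^+ 2 by rewrite addr_ge0// sqr_ge0.
pose G w := tpot mu D L w + eps * (w.1 ^+ 2 + w.2 ^+ 2).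
have supE : has_sup (G @` box rho).
  split; first by exists (G w0); exists w0.
  exists (L + eps * (2 * rho ^+ 2)) => _ [w wbox <-].
  by rewrite lerD ?tpot_le_level// ler_wpM2l ?sqbox// ltW.
have [_ [w wbox <-] Gw] := sup_adherent kap0 supE.
have Gmax v : box rho v -> G v <= G w + kap.
  move=> vbox; have : G v <= sup (G @` box rho).
    by apply: (sup_upper_bound supE); exists v.
  by lra.
have final : tpot mu D L w <= M -> tpot mu D L w0 <= M + eps * (2 * rho ^+ 2 + 1).
  move=> wM; have := Gmax w0 w0box; rewrite /G.
  have := mulr_ge0 (ltW eps0) (sq0 w0).
  have : eps * (w.1 ^+ 2 + w.2 ^+ 2) <= eps * (2 * rho ^+ 2).
    by rewrite ler_wpM2l ?sqbox// ltW.
  lra.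
(* The near-maximum [w] lies near the boundary of the box, hence far from [K]; or close to a point
   of [S], where [tpot_near] applies; or away from [S], which is contradictory. *)
have [win|wout] := pselect (box (rho - 1) w); last first.
  apply: final; apply: le_trans V'M.
  apply: (@tpot_le_far K B D L V rho) => // z Kz; exact: KD.
pose S := [set z | K z /\ (lpot D mu z <= V'%:E)%E].
have aeS : \forall z \ae mu, S z by apply: filterS2 aeK aeV => z.
have [[w' [[_ w'V] ww']]|Sfar] :=
    pselect (exists w', S w' /\ pdist w' w <= 2 * delta).
  apply: final; apply: (@tpot_near _ _ _ _ _ _ w') => //; first exact: ltW.
  move=> z; apply: nearP => //; rewrite ?pdist_ge0//.
  have := pdist_triangle z w w'; rewrite [pdist w w']pdistC -/delta; lra.
have crossbox k : box rho (cross w r k) by apply: cross_box => //; exact: ltW.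
have : 4 * eps * r ^+ 2 <= 4 * kap + (r / delta) ^+ 4.
  apply: (@tpot_max_off_mass _ _ _ _ w _ S) => //.
  - by move=> z k [Kz _]; split; apply: KD.
  - move=> z Sz; rewrite ltNge; apply/negP => zw; apply: Sfar.
    by exists z.
  - by move=> k; exact: Gmax.
have : (r / delta) ^+ 4 <= r ^+ 2 * eps.
  have rde : r / delta <= delta * eps.
    by rewrite ler_pdivrMr// mulrAC -expr2.
  have -> : (r / delta) ^+ 4 = r ^+ 2 * ((r / delta) / delta) ^+ 2.
    by field; rewrite gt_eqF.
  rewrite ler_pM2l ?exprn_gt0//.
  have rdd : r / delta / delta <= eps by rewrite ler_pdivrMr// [leRHS]mulrC.
  apply: le_trans (_ : eps ^+ 2 <= _).
    by rewrite ler_pXn2r// nnegrE ?divr_ge0// ltW.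
  by rewrite expr2 ler_piMr// ltW.
have := mulr_gt0 eps0 (exprn_gt0 2 r0).
rewrite /kap; lra.
Qed.

(** [tpot_le_max] is used with [tau] tending to 0. It speaks of high levels only, but raising the
    level only increases the truncated potential. *)
Lemma lpot_le K B D V rho w0 : 1 <= D -> 0 <= V + ln D ->
  (\forall z \ae mu, K z) -> K `<=` box B -> 0 <= B ->
  B + expR (- V) + 1 <= rho ->
  (forall z w, K z -> box rho w -> pdist z w <= D) ->
  (\forall z \ae mu, (lpot D mu z <= (V + ln D)%:E)%E) ->
  box rho w0 -> (lpot D mu w0 <= (V + ln D)%:E)%E.
Proof.
move=> D1 V0 aeK KB B0 Brho KD aeV w0box.
apply: lpot_le_tpot => L L_ge0; set V' := V + ln D.
rewrite leNgt; apply/negP => V't.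
(* The bound [(1 + tau) * V' + tau] exceeds [V'] by [tau * (V' + 1)], here half of the supposed
   gap. *)
pose tau := (tpot mu D L w0 - V') / (2 * (V' + 1)).
have V'1 : 0 < V' + 1 by rewrite ltr_wpDl.
have tau0 : 0 < tau by rewrite divr_gt0 ?subr_gt0// mulr_gt0.
have [L0 HL0] := tpot_le_max D1 V0 tau0 aeK KB B0 Brho KD aeV.
have := HL0 (Num.max L L0) w0; rewrite !le_max L_ge0 lexx orbT.
move=> /(_ isT isT w0box).
have : tpot mu D L w0 <= tpot mu D (Num.max L L0) w0.
  by apply: tpot_homo => //; rewrite le_max lexx.
have : tau * (V' + 1) = (tpot mu D L w0 - V') / 2.
  by rewrite /tau invfM mulrA mulfVK// gt_eqF.
rewrite -/V'; lra.
Qed.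

(* Frostman's theorem: [lpot D mu w0 - ln D] is the logarithmic potential of
   [mu] at [w0] as soon as [mu] lives within distance [D] of [w0]. *)
Lemma equilibrium_lpot_le K V w0 : compact K -> supported_on K mu ->
  energy mu = V%:E -> robin K = V%:E ->
  exists2 D, 1 <= D /\ (forall z, K z -> pdist z w0 <= D) &
  (lpot D mu w0 <= (V + ln D)%:E)%E.
Proof.
move=> cK muK muV KV.
have mK := compact_measurable_plane cK.
have [B B0 KB] := compact_bounded_plane cK.
(* The first three terms are the margin required by [lpot_le]; the last two put [w0] in the box. *)
pose rho := B + expR (- V) + 1 + `|w0.1| + `|w0.2|.
have eV := expR_gt0 (- V).
have n1 := normr_ge0 w0.1; have n2 := normr_ge0 w0.2.
pose D := 2 * (B + rho).
have D1 : 1 <= D by rewrite /D /rho; lra.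
have w0box : box rho w0 by split; rewrite /rho; lra.
have KD z w : K z -> box rho w -> pdist z w <= D.
  by move=> Kz; apply: pdist_box; exact: KB.
have Kbox z : K z -> box rho z.
  by move=> /KB[z1 z2]; split; rewrite /rho; lra.
have KKD z w : K z -> K w -> pdist z w <= D by move=> Kz /Kbox; exact: KD.
exists D; first by split=> // z Kz; exact: KD.
apply: (@lpot_le K B D V rho) => //.
- rewrite -lee_fin -(integral_lpot_equilibrium D1 mK KKD muK muV).
  by apply: integral_ge0 => z _; exact: lpot_ge0.
- exact: supported_ae.
- by rewrite /rho; lra.
- exact: lpot_le_ae muK muV KV.
Qed.

End Frostman.

(** * Integrals of [log |p|] for polynomials in one variable *)

Section OneVariable.
Import complex complex.ComplexField.
Context {R : realType}.
Implicit Types (mu : probability (plane R) R) (K : set (plane R)).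
Local Notation C := (complex.complex R).

Lemma logabsE (c : C) : c != 0 -> logabs c = (ln (cabs c))%:E.
Proof. by move=> c0; rewrite /logabs cabs_eq0 (negbTE c0). Qed.

Lemma logabs0 : logabs (0 : C) = -oo%E.
Proof.
by rewrite /logabs (_ : cabs 0 == 0); last by rewrite cabs_eq0.
Qed.

Lemma cabs_gt0 (c : C) : (0 < cabs c) = (c != 0).
Proof. by rewrite lt_neqAle cabs_ge0 andbT eq_sym cabs_eq0. Qed.

Lemma logabsM (c e : C) : logabs (c * e) = (logabs c + logabs e)%E.
Proof.
have [->|c0] := eqVneq c 0; first by rewrite mul0r logabs0 addNye.
have [->|e0] := eqVneq e 0; first by rewrite mulr0 logabs0 addeNy.
by rewrite !logabsE ?mulf_neq0// cabsM lnM ?posrE ?cabs_gt0.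
Qed.

Lemma cabs_real (x : R) : cabs (x%:C)%C = `|x|.
Proof. by rewrite /cabs /= expr0n /= addr0 sqrtr_sqr. Qed.

Lemma le_logabs (c e : C) : cabs c <= cabs e -> (logabs c <= logabs e)%E.
Proof.
have [->|c0] := eqVneq c 0; first by rewrite logabs0 leNye.
have c1 : 0 < cabs c by rewrite cabs_gt0.
move=> ce; have e1 : 0 < cabs e by apply: lt_le_trans ce.
by rewrite !logabsE -?cabs_gt0// lee_fin ler_ln.
Qed.

Lemma expeR_logabs (c : C) : expeR (logabs c) = (cabs c)%:E.
Proof.
have [->|c0] := eqVneq c 0.
  by rewrite logabs0 /=; congr EFin; apply/esym/eqP; rewrite cabs_eq0.
by rewrite logabsE//= lnK// posrE cabs_gt0.
Qed.

Lemma logabs_toC (z w : plane R) : logabs (toC z - toC w) =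
  if pdist z w == 0 then -oo%E else (ln (pdist z w))%:E.
Proof. by []. Qed.

Lemma measurable_logabs_toC (w : plane R) :
  measurable_fun setT (fun z : plane R => logabs (toC z - toC w)).
Proof.
have mp : measurable_fun setT (fun z : plane R => pdist z w).
  exact: measurable_pdist.
rewrite (_ : (fun z => _) = fun z : plane R =>
    if pdist z w == 0 then -oo%E else (ln (pdist z w))%:E)//.
apply: measurable_fun_ifT.
- exact: measurable_fun_eqr.
- exact: measurable_cst.
- by apply/measurable_EFinP; exact: (measurableT_comp (@measurable_ln R) mp).
Qed.

(** On [K] the integrand is [ln D] minus the kernel, so Frostman's bound on the potential at [w]
    gives both integrability and the lower bound. *)
Lemma integral_log_dist_ge K mu V (w : plane R) : compact K ->
  supported_on K mu -> energy mu = V%:E -> robin K = V%:E ->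
  mu.-integrable setT (fun z => logabs (toC z - toC w)) /\
  ((- V)%:E <= \int[mu]_z logabs (toC z - toC w)%R)%E.
Proof.
move=> cK muK muV KV.
have [D [D1 KD] PV] := equilibrium_lpot_le w cK muK muV KV.
have mf := measurable_logabs_toC w.
have mk := @measurable_lker_pdistl R D w.
have ik : mu.-integrable setT (fun z => lker D (pdist z w)).
  apply/integrableP; split => //.
  under eq_integral do rewrite gee0_abs ?lker_ge0//.
  by apply: le_lt_trans PV _; rewrite ltry.
have ic : mu.-integrable setT (cst (ln D)%:E).
  by apply: finite_measure_integrable_cst.
pose g z := ((ln D)%:E - lker D (pdist z w))%E.
have ig : mu.-integrable setT g by exact: integrableB.
have fg : ae_eq mu setT (fun z => logabs (toC z - toC w)) g.
  apply: filterS (supported_ae (compact_measurable_plane cK) muK) => z Kz _.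
  rewrite logabs_toC /g; case: ifPn => [/eqP->|zw]; first by rewrite /lker eqxx.
  rewrite lkerE ?KD// ?lt_neqAle ?pdist_ge0 ?andbT 1?eq_sym//.
  by rewrite -EFinB; congr EFin; ring.
have mg : measurable_fun setT g by exact: measurable_int ig.
split.
  apply/integrableP; split => //.
  rewrite (@ae_eq_integral _ _ _ _ _ (abse \o g))//.
  - by case/integrableP : ig.
  - exact: measurableT_comp.
  - exact: measurableT_comp.
  - exact: ae_eq_abse.
rewrite (@ae_eq_integral _ _ _ _ _ g)//.
rewrite integralB// integral_cstT.
move: PV; rewrite /lpot; set I := (\int[mu]_z _)%E => PV.
apply: le_trans (_ : (ln D)%:E - (V + ln D)%:E <= _)%E.
  by rewrite -EFinB lee_fin; lra.
exact: leeB.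
Qed.

(** Each root contributes at least [- V]. Integrability is carried through the induction so that the
    integral of the sum splits. *)
Lemma integral_log_prod_ge K mu V (A : C) (rs : seq C) : compact K ->
  supported_on K mu -> energy mu = V%:E -> robin K = V%:E -> A != 0 ->
  mu.-integrable setT
    (fun z => logabs (A * \prod_(r <- rs) (toC z - r))) /\
  ((ln (cabs A) - (size rs)%:R * V)%:E <=
    \int[mu]_z logabs (A * \prod_(r <- rs) (toC z - r))%R)%E.
Proof.
move=> cK muK muV KV A0; elim: rs => [|r rs [iF leF]].
  have -> : (fun z : plane R => logabs (A * \prod_(r <- [::]) (toC z - r))) =
      cst (ln (cabs A))%:E.
    by apply/funext => z; rewrite big_nil mulr1 logabsE.
  split; first exact: finite_measure_integrable_cst.
  by rewrite integral_cstT mul0r subr0.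
pose w : plane R := (complex.Re r, complex.Im r).
have rE : r = toC w by case: r @w => x y.
have [ir ler] := integral_log_dist_ge w cK muK muV KV.
have -> : (fun z : plane R => logabs (A * \prod_(s <- r :: rs) (toC z - s))) =
    ((fun z => logabs (A * \prod_(s <- rs) (toC z - s))%R) \+
     (fun z => logabs (toC z - toC w)%R))%E.
  by apply/funext => z; rewrite big_cons mulrCA mulrC [LHS]logabsM -rE.
split; first exact: integrableD.
rewrite integralD//; apply: le_trans (leeD leF ler).
by rewrite -EFinD lee_fin /= -[in leLHS]natr1; lra.
Qed.

(** Non-polarity excludes [+oo]; the value [-oo] is excluded because the energy is a nonnegative
    integral minus [ln D]. *)
Lemma robin_equilibrium_fin K mu : compact K -> ~ polar K ->
  equilibrium_measure K mu ->
  exists2 V, robin K = V%:E & energy mu = V%:E.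
Proof.
move=> cK nK [muK muE]; have mK := compact_measurable_plane cK.
have [B B0 KB] := compact_bounded_plane cK.
pose D := 2 * (B + B) + 1.
have KD z w : K z -> K w -> pdist z w <= D.
  by move=> /KB Kz /KB Kw; have := pdist_box Kz Kw; rewrite /D; lra.
have D1 : 1 <= D by rewrite /D; lra.
have := energy_lpot D1 mK muK KD; rewrite muE.
have : (0 <= \int[mu]_z lpot D mu z)%E.
  by apply: integral_ge0 => z _; exact: lpot_ge0.
move: nK; rewrite /polar.
case: (robin K) muE => [V|//|] muE; first by exists V.
by move=> _; case: (X in (0 <= X)%E).
Qed.

Lemma Cap_ge0 K : 0 <= Cap K.
Proof. by rewrite /Cap; case: (robin K) => // r; exact: expR_ge0. Qed.

(** If the coefficient of degree [d] vanishes, the left side is [-oo]; otherwise [p] has [d] roots,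
    each contributing [log Cap(K)]. Fixing [d] instead of the degree matters later, when this
    coefficient depends on the remaining variables and may vanish at some of their values. *)
Lemma integral_logabs_poly_ge K mu (p : {poly C}) (d : nat) : compact K ->
  ~ polar K -> equilibrium_measure K mu -> (size p <= d.+1)%N ->
  (logabs (((Cap K ^+ d)%:C)%C * p`_d)%R <= \int[mu]_z logabs p.[toC z])%E.
Proof.
move=> cK nK eK pd; have [V KV muV] := robin_equilibrium_fin cK nK eK.
have [muK _] := eK.
have [p0|p0] := eqVneq p`_d 0; first by rewrite p0 mulr0 logabs0 leNye.
have sp : size p = d.+1.
  by apply/eqP; rewrite eqn_leq pd ltnNge; apply: contra p0 => /leq_sizeP ->.
have lp : lead_coef p = p`_d by rewrite lead_coefE sp.
have [rs prs] := closed_field_poly_normal p.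
rewrite lp in prs.
have srs : size rs = d.
  by move: sp; rewrite prs size_scale// size_prod_XsubC => -[].
have [_] := integral_log_prod_ge rs cK muK muV KV p0.
have -> : (fun z : plane R => logabs (p`_d * \prod_(r <- rs) (toC z - r))) =
    (fun z => logabs p.[toC z]).
  apply/funext => z; rewrite [in RHS]prs hornerZ horner_prod.
  by congr (logabs (_ * _)); apply: eq_bigr => r _; rewrite hornerXsubC.
apply: le_trans; rewrite logabsM /Cap KV srs.
have e0 : 0 < expR (- V) ^+ d by rewrite exprn_gt0// expR_gt0.
rewrite !logabsE// ?cabs_real.
  rewrite gtr0_norm// lnXn ?expR_gt0// expRK -EFinD lee_fin.
  by rewrite mulr_natl addrC mulNrn.
by rewrite -cabs_gt0 cabs_real normr_gt0 gt_eqF.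
Qed.

End OneVariable.

(** * Integration of one variable after another *)

Section SeveralVariables.
Import complex complex.ComplexField.
Context {R : realType} (n : nat) (m : nat -> nat) (a : multi_index n m -> int).
Context (K : nat -> set (plane R)) (mu : nat -> probability (plane R) R).
Local Notation C := (complex.complex R).
Implicit Types (k : nat) (kap : multi_index n m) (z : nat -> plane R).

Definition agree k kap kap' : bool :=
  [forall j : 'I_n, (j < k)%N ==> (kap j == kap' j)].

Lemma agreeP k kap kap' :
  reflect (forall j : 'I_n, (j < k)%N -> kap j = kap' j) (agree k kap kap').
Proof.
apply: (iffP forallP) => [H j jk|H j].
  by apply/eqP; have := H j; rewrite jk.
by apply/implyP => jk; rewrite H.
Qed.

(* What remains of P once the coefficient of
   z_0 ^ (kap 0) ... z_(k-1) ^ (kap (k-1)) has been extracted. *)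
Definition coef_tail k kap z : C :=
  \sum_(kap' : multi_index n m | agree k kap' kap)
    (a kap')%:~R * \prod_(j < n | (k <= j)%N) toC (z j) ^+ (kap' j : nat).

Definition cap_factor k kap : R :=
  \prod_(j < n | (j < k)%N) Cap (K j) ^+ (kap j : nat).

(** This is [c * coef_tail ko kap] as a polynomial in the variable of index [ko], the others being
    fixed by [z]; [c] carries the capacities already collected. *)
Definition coef_poly (ko : 'I_n) kap z (c : C) : {poly C} :=
  \sum_(kap' : multi_index n m | agree ko kap' kap)
    (c * ((a kap')%:~R * \prod_(j < n | (ko < j)%N) toC (z j) ^+ (kap' j : nat)))
      *: 'X^(kap' ko).

Lemma horner_coef_poly (ko : 'I_n) kap z (c : C) (w : plane R) :
  (coef_poly ko kap z c).[toC w] =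
  c * coef_tail ko kap (fun i => if i == ko then w else z i).
Proof.
rewrite horner_sum mulr_sumr; apply: eq_bigr => kap' _.
rewrite hornerZ hornerXn -!mulrA; congr (_ * (_ * _)).
rewrite [RHS](bigD1 ko) //= eqxx mulrC; congr (_ * _).
apply: eq_big => j; first by rewrite ltn_neqAle andbC eq_sym.
by move=> kj; rewrite gtn_eqF.
Qed.

Lemma agreeS (ko : 'I_n) kap kap1 kap' : agree ko kap1 kap ->
  agree ko.+1 kap' kap1 = agree ko kap' kap && (kap' ko == kap1 ko).
Proof.
move=> /agreeP H1; apply/agreeP/andP => [H|[/agreeP H /eqP He] j].
  split; last by apply/eqP/H.
  by apply/agreeP => j jk; rewrite H ?H1// ltnS ltnW.
rewrite ltnS leq_eqVlt => /orP[/eqP/val_inj -> //|jk].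
by rewrite H// H1.
Qed.

(** Selecting the power [kap1 ko] keeps exactly the multi-indices that agree with [kap1] on one more
    variable. *)
Lemma coef_poly_lead (ko : 'I_n) kap kap1 z (c : C) : agree ko kap1 kap ->
  (coef_poly ko kap z c)`_(kap1 ko) = c * coef_tail ko.+1 kap1 z.
Proof.
move=> H1; rewrite coef_sum mulr_sumr [RHS](eq_bigl _ _ (fun _ => agreeS _ H1)).
rewrite big_mkcondr /=; apply: eq_bigr => kap' _.
rewrite coefZ coefXn -(inj_eq val_inj) /= eq_sym.
by case: eqP => _; rewrite ?mulr1// mulr0.
Qed.

Lemma size_coef_poly (ko : 'I_n) kap z (c : C) (d : nat) :
  (forall kap', agree ko kap' kap -> a kap' != 0 -> (kap' ko <= d)%N) ->
  (size (coef_poly ko kap z c) <= d.+1)%N.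
Proof.
move=> H; apply: (leq_trans (size_sum _ _ _)); apply/bigmax_leqP => kap' agr.
have [->|a0] := eqVneq (a kap') 0; first by rewrite mul0r mulr0 scale0r size_poly0.
by apply: leq_trans (size_scale_leq _ _) _; rewrite size_polyXn ltnS H.
Qed.

Lemma cap_factor_ge0 k kap : 0 <= cap_factor k kap.
Proof. by apply: prodr_ge0 => j _; rewrite exprn_ge0// Cap_ge0. Qed.

Lemma cap_factorS (ko : 'I_n) kap kap1 : agree ko kap1 kap ->
  cap_factor ko.+1 kap1 = Cap (K ko) ^+ (kap1 ko : nat) * cap_factor ko kap.
Proof.
move=> /agreeP H; rewrite /cap_factor (bigD1 ko)//=; congr (_ * _).
apply: eq_big => [j|j].
  by rewrite ltnS [RHS]ltn_neqAle andbC.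
by rewrite ltnS andbC -ltn_neqAle => jk; rewrite H.
Qed.

(** Induction on the number of integrated variables. One multi-index must serve for all [z], since
    the induction hypothesis is applied under the next integral. *)
Lemma iterint_ge (k : nat) : (k <= n)%N ->
  (forall j, (j < n)%N -> compact (K j)) ->
  (forall j, (j < n)%N -> ~ polar (K j)) ->
  (forall j, (j < n)%N -> equilibrium_measure (K j) (mu j)) ->
  (exists kap, a kap != 0) ->
  exists2 kap, a kap != 0 & forall z,
    (logabs (((cap_factor k kap)%:C)%C * coef_tail k kap z)%R <=
     iterint mu k (fun z => logabs (peval a z)) z)%E.
Proof.
move=> + cK nK eK [kap0 a0]; elim: k => [|k IH] kn.
  exists kap0 => // z /=; rewrite /cap_factor big_pred0// mul1r.
  apply: le_logabs; rewrite le_eqVlt; apply/orP; left; apply/eqP.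
  by congr (cabs _); apply: eq_bigl => kap; apply/agreeP.
have [kap akap IHk] := IH (ltnW kn).
pose ko := Ordinal kn.
have agr0 : agree k kap kap by apply/agreeP.
have P0 : agree k kap kap && (a kap != 0) by rewrite agr0.
(* The exponent of the next variable is maximized over the nonzero integer coefficients, not over
   coefficients evaluated at [z]: this bounds the degree uniformly in [z]. *)
case: (@arg_maxnP _ kap (fun kap' => agree k kap' kap && (a kap' != 0))
  (fun kap' => kap' ko : nat) P0) => kap1 /andP[agr1 akap1] max1.
exists kap1 => // z /=.
have sz c : (size (coef_poly ko kap z c) <= (kap1 ko : nat).+1)%N.
  by apply: size_coef_poly => kap' agr' a'; apply: max1; rewrite agr'.
have := integral_logabs_poly_ge (cK _ kn) (nK _ kn) (eK _ kn)
  (sz ((cap_factor k kap)%:C)%C).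
rewrite (coef_poly_lead z _ (agr1 : agree ko kap1 kap)) mulrA -rmorphM /=.
rewrite -(cap_factorS (agr1 : agree ko kap1 kap)).
move=> /le_trans; apply; apply: le_integralT => w.
by rewrite horner_coef_poly; exact: IHk.
Qed.

Lemma cabs_int (i : int) : cabs (i%:~R : C) = `|i|%:~R.
Proof.
by rewrite -(rmorph_int (real_complex R)) cabs_real -intr_norm.
Qed.

(** After all [n] integrations a single nonzero integer coefficient remains, of absolute value at
    least 1. *)
Lemma mahler_ge_cap_factor :
  (forall j, (j < n)%N -> compact (K j)) ->
  (forall j, (j < n)%N -> ~ polar (K j)) ->
  (forall j, (j < n)%N -> equilibrium_measure (K j) (mu j)) ->
  (exists kap, a kap != 0) ->
  exists kap, ((\prod_(j < n) Cap (K j) ^+ (kap j : nat))%:E <= mahler mu a)%E.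
Proof.
move=> cK nK eK a0.
have [kap akap H] := iterint_ge (leqnn n) cK nK eK a0.
exists kap; rewrite /mahler.
have := H (fun=> (0, 0)); rewrite -lee_expeR expeR_logabs; apply: le_trans.
have capE : cap_factor n kap = \prod_(j < n) Cap (K j) ^+ (kap j : nat).
  by apply: eq_bigl => j; rewrite ltn_ord.
rewrite -capE /coef_tail (big_pred1 kap); last first.
  move=> kap' /=; apply/agreeP/eqP => [H'|-> //].
  by apply/ffunP => j; exact: H'.
rewrite big_pred0 ?mulr1; last by move=> j; rewrite leqNgt ltn_ord.
rewrite lee_fin cabsM cabs_real cabs_int ger0_norm ?cap_factor_ge0//.
by rewrite ler_peMr ?cap_factor_ge0// ler1z -gtz0_ge1 normr_gt0.
Qed.

End SeveralVariables.

Theorem theorem5p3 (R : realType) (n : nat)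
  (K : nat -> set (plane R)) (mu : nat -> probability (plane R) R)
  (m : nat -> nat) (a : multi_index n m -> int) :
  (forall j, (j < n)%N -> compact (K j)) ->
  (forall j, (j < n)%N -> ~ polar (K j)) ->
  (forall j, (j < n)%N -> equilibrium_measure (K j) (mu j)) ->
  (exists k, a k != 0) ->
  (forall j : 'I_n, exists k : multi_index n m, (k j : nat) = m j /\ a k != 0) ->
  (mahler mu a >= (\prod_(N < n) Num.min 1 (Cap (K N) ^+ m N))%:E)%E /\
  ((forall N, (N < n)%N -> 1 <= Cap (K N)) -> (mahler mu a >= 1)%E).
Proof.
move=> cK nK eK a0 _.
have [kap H] := mahler_ge_cap_factor cK nK eK a0.
have min_le : ((\prod_(N < n) Num.min 1 (Cap (K N) ^+ m N))%:E <= mahler mu a)%E.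
  apply: le_trans H; rewrite lee_fin; apply: ler_prod => j _.
  have cap0 := Cap_ge0 (K j).
  (* If the capacity is at least 1, so is its power. If it is less than 1, its power decreases with
     the exponent, and [kap j <= m j] because [kap j] lies in ['I_(m j).+1]. *)
  rewrite le_min ler01 exprn_ge0//=; have [cap1|cap1] := leP 1 (Cap (K j)).
    by rewrite ge_min exprn_ege1.
  by rewrite ge_min ler_wiXn2l ?orbT ?(ltW cap1)// -ltnS ltn_ord.
split=> // cap1; apply: le_trans min_le; rewrite lee_fin.
rewrite big1// => j _; apply/min_idPl; exact/exprn_ege1/cap1.
Qed.
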